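(* Let $\mathcal{A} = I \otimes A_0 + \sum_{q=1}^{Q_\nu-1} G_q \otimes A_q$ and $\mathcal{B} = I\otimes B$ be the blocks of the stochastic Galerkin finite element (SGFE) Stokes matrix, let the Schur complement be $\mathcal{S} = -\mathcal{B}\mathcal{A}^{-1}\mathcal{B}^{\mathrm T}$, and let $\widetilde{\mathcal{S}}_p = I\otimes D_p$, where all objects are as defined in the context. Then $$\hat{\gamma} \le \frac{\mathbf{q}^{\mathrm T}\,\mathcal{B}\mathcal{A}^{-1}\mathcal{B}^{\mathrm T}\,\mathbf{q}}{\mathbf{q}^{\mathrm T}(I\otimes D_p)\,\mathbf{q}} \le \hat{\Gamma}$$ for all nonzero $\mathbf{q}\in\mathbb{R}^{Q_z N_p}$ with the hydrostatic pressure excluded (i.e. coefficient vectors of functions in $S^k\otimes W_0^h$), with $$\hat{\gamma} := (\overline{\nu}_0+\nu_\sigma)^{-1}\,\theta\,\beta^2,\qquad \hat{\Gamma} := \underline{\delta}^{-1}\,\Delta\,\Theta .$$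
   Context: Random input. $D\subset\mathbb{R}^2$ is a bounded domain, $M\in\mathbb{N}$, $k\in\mathbb{N}$, $\sigma_\mu>0$. The functions $\mu_0$ and $\sqrt{\lambda_m}\,\mu_m$ ($m\ge 1$) lie in $L^\infty(D)$, and $(\|\sqrt{\lambda_m}\mu_m\|_{L^\infty(D)})_{m\ge1}\in\ell^1(\mathbb{N})$; here $\mu_0$ is the mean and $(\lambda_m,\mu_m)$ are the Karhunen-Loève eigenpairs of a Gaussian random field. The truncated lognormal viscosity is $\nu_M(x,y)=\exp\big(\mu_0(x)+\sigma_\mu\sum_{m=1}^M\sqrt{\lambda_m}\mu_m(x)y_m\big)$, $y\in\mathbb{R}^M$. Let $\rho(y)=\prod_{m=1}^M (2\pi)^{-1/2}e^{-y_m^2/2}$ and $\langle v\rangle=\int_{\mathbb{R}^M}v(y)\rho(y)\,dy$. Hermite chaos. For a multi-index $(k_1,\dots,k_M)\in\mathbb{N}_0^M$, the associated chaos polynomial is the product of the univariate Hermite polynomials of degrees $k_m$ in $y_m$, orthonormal with respect to the standard Gaussian density. Let $Q_z=\binom{M+k}{k}$ and $Q_\nu=\binom{M+2k}{2k}$. The chaos polynomials $\psi_0,\dots,\psi_{Q_\nu-1}$ enumerate all multi-indices of total degree $\sum_m k_m\le 2k$, in such a way that $\psi_0=1$ and $\psi_0,\dots,\psi_{Q_z-1}$ are those of total degree $\le k$; the latter are the basis of the stochastic Galerkin space $S^k$. For the index $q$ with multi-index $(k_1,\dots,k_M)$ define $$\nu_q(x)=\exp\Big(\mu_0(x)+\tfrac12\sigma_\mu^2\sum_{m=1}^M\lambda_m\mu_m^2(x)\Big)\prod_{m=1}^M\frac{(\sigma_\mu\sqrt{\lambda_m}\mu_m(x))^{k_m}}{\sqrt{k_m!}},\qquad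 \overline{\nu}_q=\|\nu_q\|_{L^\infty(D)}.$$ These are the coefficients of $\nu_M$ in the Hermite chaos basis. Stochastic Galerkin matrices. $I\in\mathbb{R}^{Q_z\times Q_z}$ is the identity. $G_q\in\mathbb{R}^{Q_z\times Q_z}$ has entries $\langle\psi_q\psi_i\psi_j\rangle$, $0\le i,j\le Q_z-1$. For $q\ge1$ with multi-index $(k_1,\dots,k_M)$, $g_q=\exp\big(\tfrac{M(k+1)}{2}+\tfrac12\sum_{m=1}^M k_m\big)$, which is the constant in the inclusion bound $-g_q\le \mathbf{a}^{\mathrm T}G_q\mathbf{a}/\mathbf{a}^{\mathrm T}\mathbf{a}\le g_q$ for $\mathbf{a}\neq\mathbf{0}$. Set $\nu_\sigma=\sum_{q=1}^{Q_\nu-1}g_q\overline{\nu}_q$. Finite element matrices. Taylor-Hood $P_2/P_1$ elements on a regular triangulation of mesh size $h$: $\{\phi_i\}_{i=1}^{N_u}$ is the basis of the velocity space $V_0^h\subset H_0^1(D)^2$ of continuous piecewise quadratic vector fields, and $\{\varphi_i\}_{i=1}^{N_p}$ is the nodal basis of continuous piecewise linear functions. $W_0^h\subset L^2_0(D)$ is the pressure space of continuous piecewise linear functions with $\int_D q\,dx=0$. $A_q\in\mathbb{R}^{N_u\times N_u}$ has entries $\int_D\nu_q\nabla\phi_i\cdot\nabla\phi_j\,dx$; $A$ is the unweighted velocity Laplacian with entries $\int_D\nabla\phi_i\cdot\nabla\phi_j\,dx$; $B\in\mathbb{R}^{N_p\times N_u}$ is the divergence matrix with entries $-\int_D\varphi_i\,\nabla\cdot\phi_j\,dx$;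 $M_p$ is the pressure mass matrix with entries $\int_D\varphi_i\varphi_j\,dx$, and $D_p=\mathrm{diag}(M_p)$. A vector $\mathbf{q}\in\mathbb{R}^{Q_zN_p}$ is the coefficient vector of the function $\sum_{i,j}\mathbf{q}_{ij}\psi_i(y)\varphi_j(x)$. Constants. - $\theta,\Theta>0$ are constants (for $P_1$ elements on triangles, $\theta=\tfrac12$, $\Theta=2$) with $\theta\le\mathbf{q}^{\mathrm T}M_p\mathbf{q}/\mathbf{q}^{\mathrm T}D_p\mathbf{q}\le\Theta$ for all $\mathbf{q}\in\mathbb{R}^{N_p}\setminus\{\mathbf{0}\}$. - $\widetilde{A}_{\mathrm{mg}}\in\mathbb{R}^{N_u\times N_u}$ is the symmetric positive definite matrix representing one multigrid V-cycle, with constants $\delta,\Delta>0$ independent of $h$ such that $\delta\le\mathbf{v}^{\mathrm T}A\mathbf{v}/\mathbf{v}^{\mathrm T}\widetilde{A}_{\mathrm{mg}}\mathbf{v}\le\Delta$ for all $\mathbf{v}\in\mathbb{R}^{N_u}\setminus\{\mathbf{0}\}$. - $\underline{\delta}>0$ is a constant with $\mathbf{v}^{\mathrm T}\mathcal{A}\mathbf{v}\ge\underline{\delta}\,\mathbf{v}^{\mathrm T}(I\otimes\widetilde{A}_{\mathrm{mg}})\mathbf{v}$ for all $\mathbf{v}\in\mathbb{R}^{Q_zN_u}$. - $\beta>0$ is the inf-sup constant of the mixed SGFE discretization with spaces $S^k\otimes V_0^h$ and $S^k\otimes W_0^h$, for which $$\beta^2\le\frac{\mathbf{q}^{\mathrm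 T}(I\otimes BA^{-1}B^{\mathrm T})\mathbf{q}}{\mathbf{q}^{\mathrm T}(I\otimes M_p)\mathbf{q}}\le1$$ for all nonzero coefficient vectors $\mathbf{q}$ of functions in $S^k\otimes W_0^h$. Standing assumption. The fully discrete SGFE problem is well-posed; in particular $\mathcal{A}$ is symmetric positive definite and the discrete inf-sup condition holds ($\beta>0$). *)

(* Defs.v *)
From HB Require Import structures.
From mathcomp Require Import all_boot all_order all_algebra.
From mathcomp Require Import all_classical all_reals all_analysis.
From mathcomp.real_closed Require Import mxtens.

Set Implicit Arguments.
Unset Strict Implicit.
Unset Printing Implicit Defensive.

Import Order.TTheory GRing.Theory Num.Theory.
Import numFieldNormedType.Exports.

Local Open Scope classical_set_scope.
Local Open Scope ring_scope.

(* Lebesgue measure on R^n, realised as n-tuples: the library has the product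
   sigma-algebra on tuples but not the product measure. *)
Section LebesgueTuple.
Context {R : realType}.
Notation mR := (measurableTypeR R).
Notation leb := (@lebesgue_measure R).

Definition cons_tup n (z : mR * n.-tuple mR) : n.+1.-tuple mR :=
  [tuple of z.1 :: z.2].

Lemma measurable_cons_tup n : measurable_fun setT (@cons_tup n).
Proof. exact: measurable_cons. Qed.

Section Step.
Variables (n : nat) (mu : {sigma_finite_measure set (n.-tuple mR) -> \bar R}).

Definition leb_cons : set (n.+1.-tuple mR) -> \bar R :=
  pushforward (leb \x mu)%E (@cons_tup n).

Let leb_cons0 : leb_cons set0 = 0%E.
Proof. by rewrite /leb_cons /pushforward preimage_set0 measure0. Qed.

Let leb_cons_ge0 A : (0 <= leb_cons A)%E.
Proof. exact: (measure_ge0 (leb \x mu)%E). Qed.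

Let leb_cons_sigma_additive : semi_sigma_additive leb_cons.
Proof.
have mc A : measurable A -> measurable (@cons_tup n @^-1` A).
  by move=> mA; rewrite -[X in measurable X]setTI; exact: measurable_cons_tup.
move=> F mF tF mUF; rewrite /leb_cons /pushforward preimage_bigcup.
apply: measure_semi_sigma_additive => [k||].
- exact: mc.
- apply/trivIsetP => /= i j _ _ ij; rewrite -preimage_setI.
  by move/trivIsetP : tF => /(_ _ _ _ _ ij) ->//; rewrite preimage_set0.
- by rewrite -preimage_bigcup; exact: mc.
Qed.

HB.instance Definition _ := isMeasure.Build _ _ _ leb_cons
  leb_cons0 leb_cons_ge0 leb_cons_sigma_additive.

Let leb_cons_sigma_finite : sigma_finite setT leb_cons.
Proof.
have /sigma_finiteP[F [TF ndF Foo]] := sigma_finiteT (@lebesgue_measure R).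
have /sigma_finiteP[G [TG ndG Goo]] := sigma_finiteT mu.
pose h (t : n.+1.-tuple mR) : mR * n.-tuple mR := (thead t, [tuple of behead t]).
exists (fun k => h @^-1` (F k `*` G k)).
  rewrite -preimage_bigcup (_ : \bigcup_k _ = setT) ?preimage_setT//.
  rewrite -subTset => -[x t] _.
  have [i _ Fix] : (\bigcup_i F i) x by rewrite -TF.
  have [j _ Gjt] : (\bigcup_i G i) t by rewrite -TG.
  exists (maxn i j) => //; split => /=.
  - by move: x Fix; exact/subsetPset/ndF/leq_maxl.
  - by move: t Gjt; exact/subsetPset/ndG/leq_maxr.
move=> k; have [mF Fk] := Foo k; have [mG Gk] := Goo k; split.
- rewrite -[X in measurable X]setTI.
  apply: measurable_fun_pair => //=; last exact: measurableX.
    exact: measurable_tnth.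
  exact: measurable_behead.
- rewrite /leb_cons /pushforward -comp_preimage.
  rewrite (_ : _ \o _ = id).
    by rewrite preimage_id product_measure1E// lte_mul_pinfty// ge0_fin_numE.
  by apply/funext => -[x t]; congr pair; exact/val_inj.
Qed.

HB.instance Definition _ := Measure_isSigmaFinite.Build _ _ _ leb_cons
  leb_cons_sigma_finite.

End Step.

Fixpoint leb_tuple (n : nat) : {sigma_finite_measure set (n.-tuple mR) -> \bar R} :=
  match n with
  | 0 => \d_([tuple] : 0.-tuple mR)
  | n'.+1 => leb_cons (leb_tuple n')
  end.
End LebesgueTuple.

Section Plane.
Context {R : realType}.
Implicit Types (D : set (R * R)) (f : R * R -> R).

Definition leb2 : {measure set (measurableTypeR R * measurableTypeR R) -> \bar R} :=
  (@lebesgue_measure R \x @lebesgue_measure R)%E.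

Definition bounded_domain D :=
  [/\ D !=set0, open D, connected D & bounded_set D].

(* Functions on D are total functions on the plane of which only the values on
   D matter, hence the extension by zero [f \_ D]. *)
Definition Linfty D f := f \_ D \in Lfun leb2 +oo%E.

Definition norm_Linfty D f : \bar R := 'N[leb2]_+oo%E [EFin \o (f \_ D)]%E.

End Plane.

Section GaussianField.
Context {R : realType} (D : set (R * R)).

(* [normal_prob m 0] is not a point mass, so degenerate normal laws are treated
   apart. *)
Definition gaussian_law (d : measure_display) (Omega : measurableType d)
    (P : probability Omega R) (X : Omega -> R) :=
  exists m s : R, forall A : set R, measurable A ->
    P (X @^-1` A) = (if s == 0 then \d_m A else normal_prob m s A).

Definition gaussian_field (d : measure_display) (Omega : measurableType d)
    (P : probability Omega R) (z : R * R -> {RV P >-> R})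
    (mean : R * R -> R) (cov : R * R -> R * R -> R) :=
  [/\ forall n (x : 'I_n -> R * R) (c : 'I_n -> R), (forall i, D (x i)) ->
        gaussian_law P (fun w => \sum_(i < n) c i * z (x i) w),
      forall x, D x -> ('E_P[z x] = (mean x)%:E)%E &
      forall x x', D x -> D x' -> covariance P (z x) (z x') = (cov x x')%:E].

(* Eigenpairs, indexed from 1, of the integral operator with kernel [c]. *)
Definition KL_eigenpairs (c : R * R -> R * R -> R) (lam : nat -> R)
    (mu : nat -> R * R -> R) :=
  [/\ forall m, (0 < m)%N -> 0 <= lam m,
      forall m, (0 < m)%N -> mu m \_ D \in Lfun leb2 2%:E,
      forall m n, (0 < m)%N -> (0 < n)%N ->
        \int[leb2]_(x in D) (mu m x * mu n x) = (m == n)%:R &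
      forall m, (0 < m)%N -> {ae leb2, forall x, D x ->
        leb2.-integrable D (EFin \o (fun x' => c x x' * mu m x')) /\
        \int[leb2]_(x' in D) (c x x' * mu m x') = lam m * mu m x}].

End GaussianField.

Section Chaos.
Context {R : realType} {M : nat}.
Implicit Types (a : {ffun 'I_M -> nat}) (y : M.-tuple R).

Definition gauss_density y : R :=
  \prod_(m < M) ((Num.sqrt (2 * pi))^-1 * expR (- (tnth y m ^+ 2 / 2))).

Definition gauss_mean (v : M.-tuple R -> R) : R :=
  \int[leb_tuple M]_y (v y * gauss_density y).

(* The pair (He_n, He_n.+1) of monic (probabilists') Hermite polynomials, from
   He_n.+2 = X He_n.+1 - (n + 1) He_n. *)
Fixpoint hermite_pair n : {poly R} * {poly R} :=
  if n is n'.+1 then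
    let: (p, q) := hermite_pair n' in (q, 'X * q - (n'.+1)%:R *: p)
  else (1, 'X).

Definition hermite n : {poly R} :=
  (Num.sqrt (n`!)%:R)^-1 *: (hermite_pair n).1.

Definition total_deg a : nat := \sum_(m < M) a m.

Definition chaos_poly a y : R := \prod_(m < M) (hermite (a m)).[tnth y m].

Variables (k : nat) (alpha : nat -> {ffun 'I_M -> nat}).

Definition chaos_dim n : nat := 'C(M + n, n).

Local Notation Q_z := (chaos_dim k).
Local Notation Q_nu := (chaos_dim (2 * k)).

(* [alpha q] is the multi-index of psi_q; only q < Q_nu is relevant. *)
Definition chaos_enum :=
  [/\ forall q r, (q < Q_nu)%N -> (r < Q_nu)%N -> alpha q = alpha r -> q = r,
      forall a, (exists2 q, (q < Q_nu)%N & alpha q = a) <->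
                (total_deg a <= 2 * k)%N,
      forall a, (exists2 q, (q < Q_z)%N & alpha q = a) <->
                (total_deg a <= k)%N &
      alpha 0%N = [ffun=> 0%N]].

Definition psi q : M.-tuple R -> R := chaos_poly (alpha q).

Definition galerkin_mx q : 'M[R]_Q_z :=
  \matrix_(i, j) gauss_mean (fun y => psi q y * psi i y * psi j y).

Definition g_const q : R :=
  expR ((M * (k + 1))%:R / 2 + 2^-1 * (total_deg (alpha q))%:R).

Definition S_k (s : M.-tuple R -> R) :=
  exists c : 'I_Q_z -> R, forall y, s y = \sum_i c i * psi i y.

End Chaos.

Section Viscosity.
Context {R : realType} {M : nat}.
Variables (sigma : R) (mu0 : R * R -> R) (lam : nat -> R)
  (mu : nat -> R * R -> R).

(* The m-th coordinate, m : 'I_M, belongs to the eigenpair of index m.+1. *)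
Definition nu_coeff (a : {ffun 'I_M -> nat}) (x : R * R) : R :=
  expR (mu0 x + 2^-1 * sigma ^+ 2 * \sum_(m < M) lam m.+1 * mu m.+1 x ^+ 2) *
  \prod_(m < M) ((sigma * Num.sqrt (lam m.+1) * mu m.+1 x) ^+ a m /
                 Num.sqrt ((a m)`!)%:R).

Definition nu_bar (D : set (R * R)) (a : {ffun 'I_M -> nat}) : R :=
  fine (norm_Linfty D (nu_coeff a)).

Definition nu_sigma (k : nat) (D : set (R * R))
    (alpha : nat -> {ffun 'I_M -> nat}) : R :=
  \sum_(1 <= q < chaos_dim (M := M) (2 * k)) g_const k alpha q * nu_bar D (alpha q).

End Viscosity.

Section Mesh.
Context {R : realType} {Np : nat}.
Variables (D : set (R * R)) (p : 'I_Np -> R * R) (Th : {set {set 'I_Np}}).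

(* Convex hull of the vertices p_i, i \in K; empty when K is. *)
Definition simplex (K : {set 'I_Np}) : set (R * R) :=
  [set x | exists t : 'I_Np -> R,
    [/\ forall i, 0 <= t i, forall i, i \notin K -> t i = 0,
        \sum_i t i = 1 & \sum_i t i *: p i = x]].

Definition affinely_independent (K : {set 'I_Np}) :=
  forall t : 'I_Np -> R, (forall i, i \notin K -> t i = 0) ->
    \sum_i t i = 0 -> \sum_i t i *: p i = 0 -> forall i, t i = 0.

Definition eucl_dist (x y : R * R) : R :=
  Num.sqrt ((x.1 - y.1) ^+ 2 + (x.2 - y.2) ^+ 2).

Definition mesh_size : R :=
  \big[Num.max/0]_(K in Th) \big[Num.max/0]_(i in K)
    \big[Num.max/0]_(j in K) eucl_dist (p i) (p j).

(* Conforming triangulation with vertices p_i: a triangle is a set of three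
   vertex indices, and two triangles meet in the hull of their common vertices,
   that is in nothing, a vertex or an edge. *)
Definition regular_triangulation (h : R) :=
  [/\ forall K, K \in Th -> #|K| = 3%N /\ affinely_independent K,
      forall K L, K \in Th -> L \in Th ->
        simplex K `&` simplex L = simplex (K :&: L),
      forall i, exists2 K, K \in Th & i \in K,
      closure D = \bigcup_(K in [set K | K \in Th]) simplex K &
      h = mesh_size].

Definition piecewise_poly (n : nat) (f : R * R -> R) :=
  forall K, K \in Th -> exists c : nat -> nat -> R, forall x, simplex K x ->
    f x = \sum_(i < n.+1) \sum_(j < n.+1 | (i + j <= n)%N)
            c i j * x.1 ^+ i * x.2 ^+ j.

Definition continuous_pw_poly n f :=
  piecewise_poly n f /\ {within closure D, continuous f}.

(* Elements of V_0^h are extended by zero outside D, in particular to the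
   boundary. *)
Definition V0h (v : 'I_2 -> R * R -> R) :=
  forall a, continuous_pw_poly 2 (v a) /\ (forall x, ~ D x -> v a x = 0).

Definition V0h_basis (Nu : nat) (phi : 'I_Nu -> 'I_2 -> R * R -> R) :=
  (forall i, V0h (phi i)) /\
  forall v, V0h v -> exists! c : 'cV[R]_Nu,
    forall a x, v a x = \sum_i c i 0 * phi i a x.

Definition P1_nodal_basis (vphi : 'I_Np -> R * R -> R) :=
  (forall i, continuous_pw_poly 1 (vphi i)) /\
  (forall i j, vphi i (p j) = (i == j)%:R).

Definition W0h (w : R * R -> R) :=
  continuous_pw_poly 1 w /\ \int[leb2]_(x in D) w x = 0.

Definition unit_vec (b : 'I_2) : R * R := if b == 0 then (1, 0) else (0, 1).

(* Elementwise partial derivative, set to 0 on the (null) union of the edges;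
   for a continuous piecewise polynomial it is the weak derivative. *)
Definition partial (b : 'I_2) (f : R * R -> R) : R * R -> R :=
  (fun x => 'D_(unit_vec b) f x) \_
    (\bigcup_(K in [set K | K \in Th]) (simplex K)°).

Definition grad_dot (v w : 'I_2 -> R * R -> R) (x : R * R) : R :=
  \sum_(a < 2) \sum_(b < 2) partial b (v a) x * partial b (w a) x.

Definition divergence (v : 'I_2 -> R * R -> R) (x : R * R) : R :=
  \sum_(a < 2) partial a (v a) x.

Definition stiffness_mx (Nu : nat) (phi : 'I_Nu -> 'I_2 -> R * R -> R)
    (nu : R * R -> R) : 'M[R]_Nu :=
  \matrix_(i, j) \int[leb2]_(x in D) (nu x * grad_dot (phi i) (phi j) x).

Definition divergence_mx (Nu : nat) (phi : 'I_Nu -> 'I_2 -> R * R -> R)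
    (vphi : 'I_Np -> R * R -> R) : 'M[R]_(Np, Nu) :=
  \matrix_(i, j) - \int[leb2]_(x in D) (vphi i x * divergence (phi j) x).

Definition mass_mx (vphi : 'I_Np -> R * R -> R) : 'M[R]_Np :=
  \matrix_(i, j) \int[leb2]_(x in D) (vphi i x * vphi j x).

(* [q] is the coefficient vector of a function in the algebraic tensor product
   of S^k and W_0^h; [mxtens_index (i, j)] is the position of q_ij. *)
Definition coeff_of_Sk_W0h (M k : nat) (alpha : nat -> {ffun 'I_M -> nat})
    (vphi : 'I_Np -> R * R -> R)
    (q : 'cV[R]_(chaos_dim (M := M) k * Np)) :=
  exists (n : nat) (s : 'I_n -> M.-tuple R -> R) (w : 'I_n -> R * R -> R),
    [/\ forall l, S_k k alpha (s l), forall l, W0h (w l) &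
        forall y x, closure D x ->
          \sum_i \sum_j q (mxtens_index (i, j)) 0 * psi alpha i y * vphi j x =
          \sum_l s l y * w l x].

End Mesh.

Section Matrices.
Context {R : realType}.

Definition quad n (K : 'M[R]_n) (v : 'cV[R]_n) : R := (v^T *m K *m v) 0 0.

Definition SPD n (K : 'M[R]_n) :=
  K^T = K /\ forall v : 'cV[R]_n, v != 0 -> 0 < quad K v.

Definition diag_part n (K : 'M[R]_n) : 'M[R]_n := diag_mx (\row_i K i i).

End Matrices.

(* Main.v *)
Require Import Defs.
From HB Require Import structures.
From mathcomp Require Import all_boot all_order all_algebra.
From mathcomp Require Import all_classical all_reals all_analysis.
From mathcomp.real_closed Require Import mxtens.
From mathcomp Require Import measurable_realfun ess_sup_inf ring lra.

(** The bounds on the Schur complement come from comparing [calA] with the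
    block-diagonal matrix [1 *t A] of the unweighted Laplacian, in the order of
    quadratic forms; inversion reverses this order, congruence by [calB^T]
    preserves it.

    Comparison from above, [calA <= (nubar 0 + nusigma) (1 *t A)].  At every
    point [x], the integrand of the quadratic form of [G_q *t A_q] is [nu_q x]
    times a sum, over the four pairs (component, direction), of values of the
    quadratic form of [G_q] at the vector of partial derivatives of the chaos
    coefficients of the velocity ([quad_tens_gram]).  The inclusion bound for
    [G_q] thus applies pointwise, with the integrand of [1 *t A] on the right,
    and [nu_q] is almost everywhere at most its essential supremum; no spectral
    decomposition is involved ([quad_tens_stiffness_le]).  To integrate this
    estimate one needs integrability: the partial derivatives of piecewise
    polynomials are measurable and bounded on [D] ([bmeas_partial]), and the
    chaos coefficients [nu_q] of the viscosity are essentially bounded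
    ([ess_bounded_nu_coeff]).

    Comparison from below, [1 *t A <= (Delta / udelta) calA], chains the two
    multigrid bounds through [1 *t Amg].

    Inversion is [SPD_inv_le], a consequence of the variational inequality
    [2 w.v - v.Kv <= w.K^-1 w] ([SPD_dual_le]).  It yields bounds of the Schur
    complement by [1 *t (B A^-1 B^T)], which the inf-sup condition compares
    with the pressure mass matrix, and the mass matrix is compared with its
    diagonal block by block. *)

Set Implicit Arguments.
Unset Strict Implicit.
Unset Printing Implicit Defensive.

Import Order.TTheory GRing.Theory Num.Theory.
Import numFieldNormedType.Exports.

Local Open Scope classical_set_scope.
Local Open Scope ring_scope.

(** Carries the product sigma-algebra of the measure [leb2]. *)
Local Notation plane R := (measurableTypeR R * measurableTypeR R)%type.

(** * Quadratic forms, tensor products and inversion *)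

Section QuadraticForms.
Context {R : realType}.

Lemma quadE n (K : 'M[R]_n) v : quad K v = \sum_i \sum_j K i j * (v i 0 * v j 0).
Proof.
rewrite /quad !mxE exchange_big /=; apply: eq_bigr => j _.
by rewrite !mxE mulr_suml; apply: eq_bigr => i _; rewrite !mxE mulrCA mulrA.
Qed.

Lemma quadD n (K L : 'M[R]_n) v : quad (K + L) v = quad K v + quad L v.
Proof. by rewrite /quad mulmxDr mulmxDl mxE. Qed.

Lemma quad_sum n I (r : seq I) (P : pred I) (F : I -> 'M[R]_n) v :
  quad (\sum_(i <- r | P i) F i) v = \sum_(i <- r | P i) quad (F i) v.
Proof. by rewrite /quad mulmx_sumr mulmx_suml summxE. Qed.

Lemma quad0r n (K : 'M[R]_n) : quad K 0 = 0.
Proof. by rewrite /quad mulmx0 mxE. Qed.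

Lemma quad_congr m n (B : 'M[R]_(m, n)) K q :
  quad (B *m K *m B^T) q = quad K (B^T *m q).
Proof. by rewrite /quad trmx_mul trmxK !mulmxA. Qed.

Lemma SPD_ge0 n (K : 'M[R]_n) : SPD K -> forall v, 0 <= quad K v.
Proof.
by move=> [_ K_gt0] v; have [->|/K_gt0/ltW//] := eqVneq v 0; rewrite quad0r.
Qed.

(** A nonzero row of the left kernel would be a vector with vanishing form. *)
Lemma SPD_unitmx n (K : 'M[R]_n) : SPD K -> K \in unitmx.
Proof.
move=> [_ K_gt0]; rewrite -row_free_unit -kermx_eq0; apply/eqP/row_matrixP => i.
rewrite row0; apply/eqP; rewrite -(inj_eq trmx_inj) trmx0.
apply/contraT => /K_gt0.
by rewrite /quad trmxK -row_mul mulmx_ker row0 mul0mx mxE ltxx.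
Qed.

(** A vector indexed by pairs, seen as a family of [m] vectors of length [n]:
    the coefficients in front of the chaos polynomials. *)
Definition slice m n (v : 'cV[R]_(m * n)) i : 'cV[R]_n :=
  \col_j v (mxtens_index (i, j)) 0.

Lemma sum_mxtens_index m n (F : 'I_(m * n) -> R) :
  \sum_k F k = \sum_i \sum_j F (mxtens_index (i, j)).
Proof.
rewrite pair_big (reindex (@mxtens_index m n)) /=; last first.
  exists (@mxtens_unindex m n) => k _; first exact: mxtens_indexK.
  exact: mxtens_unindexK.
by apply: eq_bigr => -[].
Qed.

Lemma slice_neq0 m n (v : 'cV[R]_(m * n)) : v != 0 -> exists i, slice v i != 0.
Proof.
move=> v0; apply/existsP; apply: contraR v0 => /existsPn v0.
apply/eqP/matrixP => k j; rewrite (ord1 j); case: (mxtens_indexP k) => i l.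
by have /negPn/eqP/matrixP/(_ l 0) := v0 i; rewrite !mxE.
Qed.

Lemma quad_tens m n (G : 'M[R]_m) (K : 'M[R]_n) v :
  quad (G *t K) v =
  \sum_i \sum_j G i j * ((slice v i)^T *m K *m slice v j) 0 0.
Proof.
rewrite quadE sum_mxtens_index; apply: eq_bigr => i _.
under eq_bigr => k _ do rewrite sum_mxtens_index.
rewrite exchange_big; apply: eq_bigr => j _ /=.
rewrite !mxE mulr_sumr exchange_big; apply: eq_bigr => l _ /=.
rewrite !mxE mulr_suml mulr_sumr; apply: eq_bigr => k _.
by rewrite tensmxE !mxE; ring.
Qed.

Lemma quad_tens1 m n (K : 'M[R]_n) (v : 'cV[R]_(m * n)) :
  quad (1%:M *t K) v = \sum_i quad K (slice v i).
Proof.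
rewrite quad_tens; apply: eq_bigr => i _.
rewrite (bigD1 i) //= mxE eqxx mul1r big1 ?addr0 // => j ij.
by rewrite mxE eq_sym (negbTE ij) mul0r.
Qed.

Lemma quad_tens1_le m n (K L : 'M[R]_n) : (forall v, quad K v <= quad L v) ->
  forall v : 'cV[R]_(m * n), quad (1%:M *t K) v <= quad (1%:M *t L) v.
Proof. by move=> KL v; rewrite !quad_tens1; apply: ler_sum. Qed.

Lemma quadZ n a (K : 'M[R]_n) v : quad (a *: K) v = a * quad K v.
Proof. by rewrite /quad -scalemxAr -scalemxAl mxE. Qed.

Lemma tensmxZr m n p q a (G : 'M[R]_(m, n)) (K : 'M[R]_(p, q)) :
  G *t (a *: K) = a *: (G *t K).
Proof. by apply/matrixP => i j; rewrite !mxE mulrCA. Qed.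

Lemma SPD_tens1 m n (K : 'M[R]_n) : SPD K -> SPD ((1%:M : 'M[R]_m) *t K).
Proof.
move=> sK; split; first by rewrite trmx_tens trmx1 sK.1.
move=> v /slice_neq0[i vi0]; rewrite quad_tens1 (bigD1 i)//=.
by rewrite ltr_pwDl ?sK.2// sumr_ge0// => j _; exact: SPD_ge0.
Qed.

Lemma invmx_tens1 m n (K : 'M[R]_n) : K \in unitmx ->
  invmx ((1%:M : 'M[R]_m) *t K) = 1%:M *t invmx K.
Proof.
move=> uK; have E : (1%:M *t K) *m (1%:M *t invmx K) = 1%:M :> 'M[R]_(m * n).
  rewrite tensmx_mul mulmx1 mulmxV//; apply/matrixP => i j.
  case: (mxtens_indexP i) => i1 i2; case: (mxtens_indexP j) => j1 j2.
  rewrite tensmxE !mxE (can_eq (@mxtens_indexK m n)) xpair_eqE.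
  by rewrite -natrM mulnb.
have [uT _] := mulmx1_unit E.
by rewrite -[LHS]mulmx1 -E mulmxA mulVmx// mul1mx.
Qed.

(** The gap between the two sides is the form of [K] at [K^-1 w - v]. *)
Lemma SPD_dual_le n (K : 'M[R]_n) : SPD K -> forall w v,
  2 * (w^T *m v) 0 0 - quad K v <= quad (invmx K) w.
Proof.
move=> sK w v; have uK := SPD_unitmx sK; rewrite -subr_ge0.
suff -> : quad (invmx K) w - (2 * (w^T *m v) 0 0 - quad K v) =
          quad K (invmx K *m w - v) by exact: SPD_ge0.
have iT : (invmx K)^T = invmx K by rewrite trmx_inv sK.1.
have vw : (v^T *m w) 0 0 = (w^T *m v) 0 0.
  by rewrite -[in RHS](trmxK v) -trmx_mul [RHS]mxE.
rewrite /quad [(_ - v)^T]linearB /= trmx_mul iT !mulmxBl !mulmxBr.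
rewrite -!mulmxA (mulKVmx uK) (mulKmx uK).
have mxB (P Q : 'M[R]_1) : (P - Q) 0 0 = P 0 0 - Q 0 0 by rewrite !mxE.
by rewrite !mxB vw; ring.
Qed.

(** Inversion reverses the order of positive definite forms: [SPD_dual_le]
    for [K] is evaluated at the maximiser [L^-1 w] of the inequality for [L],
    rescaled by [c^-1], the scaling that optimises the result. *)
Lemma SPD_inv_le n (K L : 'M[R]_n) c : SPD K -> SPD L -> 0 < c ->
  (forall v, quad K v <= c * quad L v) ->
  forall w, quad (invmx L) w <= c * quad (invmx K) w.
Proof.
move=> sK sL c0 KL w.
set v := invmx L *m w; set s := quad (invmx L) w.
have uL := SPD_unitmx sL.
have wv : (w^T *m v) 0 0 = s by rewrite /s /quad mulmxA.
have Lv : quad L v = s.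
  by rewrite /quad /v trmx_mul trmx_inv sL.1 -!mulmxA mulKVmx// mulmxA.
have := SPD_dual_le sK w (c^-1 *: v).
have -> : (w^T *m (c^-1 *: v)) 0 0 = c^-1 * s by rewrite -scalemxAr mxE wv.
have -> : quad K (c^-1 *: v) = c^-1 ^+ 2 * quad K v.
  by rewrite /quad -scalemxAr linearZ /= -!scalemxAl !mxE mulrA -expr2.
have := KL v; rewrite Lv => Kv H.
rewrite mulrC -ler_pdivrMr// mulrC.
apply: le_trans H; rewrite lerBrDr -lerBrDl.
rewrite (le_trans (ler_wpM2l _ Kv)) ?sqr_ge0//.
by rewrite expr2 -mulrA mulKf ?gt_eqF//; lra.
Qed.

Lemma tensmx_sumr m n I (r : seq I) (P : pred I) (G : 'M[R]_m)
    (K : I -> 'M[R]_n) :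
  G *t (\sum_(i <- r | P i) K i) = \sum_(i <- r | P i) (G *t K i).
Proof.
apply/matrixP => i j; rewrite mxE !summxE mulr_sumr.
by apply: eq_bigr => l _; rewrite mxE.
Qed.

(** A rank one second factor collapses the tensor product to the form of [G]
    at the vector of pairings of the slices with [d]. *)
Lemma quad_tens_rank1 m n (G : 'M[R]_m) (d : 'cV[R]_n) v :
  quad (G *t (d *m d^T)) v = quad G (\col_i ((slice v i)^T *m d) 0 0).
Proof.
rewrite quad_tens quadE; apply: eq_bigr => i _; apply: eq_bigr => j _.
congr (_ * _); rewrite [in RHS]mxE [X in _ = _ * X]mxE mulmxA -mulmxA.
have -> : d^T *m slice v j = ((slice v j)^T *m d)^T by rewrite trmx_mul trmxK.
by rewrite [LHS]mxE big_ord1 [X in _ * X]mxE.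
Qed.

Lemma quad_diag_part n (K : 'M[R]_n) v :
  quad (diag_part K) v = \sum_i K i i * v i 0 ^+ 2.
Proof.
rewrite /quad mxE; apply: eq_bigr => i _.
by rewrite /diag_part mul_mx_diag !mxE expr2; ring.
Qed.

Lemma quad_id n (w : 'cV[R]_n) : quad 1%:M w = (w^T *m w) 0 0.
Proof. by rewrite /quad mulmx1. Qed.

Lemma quad_id_gt0 n (w : 'cV[R]_n) : w != 0 -> 0 < quad 1%:M w.
Proof.
have sq0 i : true -> 0 <= w^T 0 i * w i 0 by rewrite mxE -expr2 sqr_ge0.
rewrite quad_id mxE => w0; rewrite lt_def sumr_ge0// andbT.
apply: contra w0; rewrite psumr_eq0// => /allP w0.
apply/eqP/matrixP => i j; rewrite (ord1 j) mxE.
by have := w0 i (mem_index_enum _); rewrite /= mxE mulf_eq0 orbb => /eqP.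
Qed.

Lemma quad_id_ge0 n (w : 'cV[R]_n) : 0 <= quad 1%:M w.
Proof. by have [->|/quad_id_gt0/ltW//] := eqVneq w 0; rewrite quad0r. Qed.

End QuadraticForms.

(** * Bounded measurable functions on a plane domain *)

Section Plane.
Context {R : realType}.

(** The measurable structure of the plane is the product sigma-algebra, so an
    open set has to be written as a countable union of rectangles: the squares
    with rational centre and radius that it contains. *)
Lemma open_measurable2 (U : set (R * R)) :
  open U -> measurable (U : set (plane R)).
Proof.
move=> oU.
pose box (a : rat * rat * rat) : set (R * R) :=
  ball (ratr a.1.1 : R) (ratr a.2 : R) `*` ball (ratr a.1.2 : R) (ratr a.2).
pose F a := if `[< box a `<=` U >] then box a else set0.
suff -> : U = \bigcup_a F a.
  apply: countable_bigcupT_measurable => // a.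
  rewrite /F; case: ifP => // _; apply: measurableX; apply: open_measurable;
    exact: ball_open.
apply/seteqP; split => [x Ux|x [a _]]; last first.
  by rewrite /F; case: asboolP => // /[apply].
have /nbhs_ballP[e /= e0 eU] : nbhs x U by exact: open_nbhs_nbhs.
have e4 : 0 < e / 4 by rewrite divr_gt0.
(* A centre within e / 4 < r is covered, and r + e / 4 < e keeps the square
   inside the ball. *)
have [r] : exists r : rat, e / 4 < ratr r < e / 2.
  have [|y [/= + [r _ ry]]] :=
    @dense_rat R (ball (3 * e / 8) (e / 8)) _ (ball_open _ _).
    by exists (3 * e / 8); apply: ballxx; rewrite divr_gt0.
  rewrite -ry => yb; exists r; move: yb; rewrite /ball/= ltr_norml; lra.
move=> /andP[r1 r2].
have near_rat (t : R) : exists a : rat, `|ratr a - t| < e / 4.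
  have [|y [/= + [a _ ay]]] := @dense_rat R (ball t (e / 4)) _ (ball_open _ _).
    by exists t; exact: ballxx.
  by rewrite -ay /ball/= distrC => ?; exists a.
have [a1 xa1] := near_rat x.1; have [a2 xa2] := near_rat x.2.
exists (a1, a2, r) => //; rewrite /F ifT; last first.
  apply/asboolP => y [/= y1 y2]; apply: eU; split; rewrite /ball/=.
    rewrite -[_ - _](subrKA (ratr a1)) (le_lt_trans (ler_normD _ _))//.
    by move: y1 xa1; rewrite /ball/= (distrC x.1); lra.
  rewrite -[_ - _](subrKA (ratr a2)) (le_lt_trans (ler_normD _ _))//.
  by move: y2 xa2; rewrite /ball/= (distrC x.2); lra.
by split; rewrite /ball/=; [move: xa1|move: xa2]; lra.
Qed.

Variable D : set (R * R).

(** The unweighted integrands are built from polynomials, which are measurable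
    on the whole plane but bounded on [D] only. *)
Definition bmeas (f : R * R -> R) :=
  measurable_fun setT (f : plane R -> R) /\
  exists C, forall x, D x -> `|f x| <= C.

Lemma bmeas_cst a : bmeas (cst a).
Proof. by split; [exact: measurable_cst|exists `|a|]. Qed.

Lemma bmeasD f g : bmeas f -> bmeas g -> bmeas (f \+ g).
Proof.
move=> [mf [C fC]] [mg [C' gC]]; split; first exact: measurable_funD.
exists (C + C') => x Dx; rewrite (le_trans (ler_normD _ _))//.
by rewrite lerD ?fC ?gC.
Qed.

Lemma bmeasM f g : bmeas f -> bmeas g -> bmeas (f \* g).
Proof.
move=> [mf [C fC]] [mg [C' gC]]; split; first exact: measurable_funM.
by exists (C * C') => x Dx; rewrite normrM ler_pM ?fC ?gC.
Qed.

Lemma bmeas_sum I (r : seq I) (P : pred I) (f : I -> R * R -> R) :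
  (forall i, P i -> bmeas (f i)) ->
  bmeas (fun x => \sum_(i <- r | P i) f i x).
Proof.
move=> bf; rewrite -fct_sumE; elim/big_ind: _ => //; first exact: bmeas_cst.
exact: bmeasD.
Qed.

(** Contains the coordinates and is closed under sums and products, hence
    contains the polynomials; this avoids an explicit formula for their
    derivatives. *)
Definition bmeas_derivable (v : R * R) (f : R * R -> R) :=
  bmeas f /\ exists2 g, bmeas g & forall x, is_derive x v f (g x).

Lemma bmeas_derivable_cst v a : bmeas_derivable v (cst a).
Proof.
split; first exact: bmeas_cst.
by exists (cst 0); [exact: bmeas_cst|move=> x; exact: is_derive_cst].
Qed.

Lemma bmeas_derivableD v f g :
  bmeas_derivable v f -> bmeas_derivable v g -> bmeas_derivable v (f \+ g).
Proof.
move=> [bf [df bdf fdf]] [bg [dg bdg gdg]]; split; first exact: bmeasD.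
by exists (df \+ dg); [exact: bmeasD|move=> x; exact: is_deriveD].
Qed.

Lemma bmeas_derivableM v f g :
  bmeas_derivable v f -> bmeas_derivable v g -> bmeas_derivable v (f \* g).
Proof.
move=> [bf [df bdf fdf]] [bg [dg bdg gdg]]; split; first exact: bmeasM.
exists ((f \* dg) \+ (g \* df)); first by apply: bmeasD; exact: bmeasM.
by move=> x; exact: is_deriveM.
Qed.

Lemma bmeas_derivableX v f n :
  bmeas_derivable v f -> bmeas_derivable v (fun x => f x ^+ n).
Proof.
move=> bf; elim: n => [|n IH]; first exact: (bmeas_derivable_cst v 1).
rewrite (_ : (fun x => _) = f \* (fun x => f x ^+ n)).
  exact: bmeas_derivableM.
by apply/funext => x; rewrite /= exprS.
Qed.

Lemma bmeas_derivable_sum v I (r : seq I) (P : pred I) (f : I -> R * R -> R) :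
  (forall i, P i -> bmeas_derivable v (f i)) ->
  bmeas_derivable v (fun x => \sum_(i <- r | P i) f i x).
Proof.
move=> bf; rewrite -fct_sumE; elim/big_ind: _ => //.
  exact: bmeas_derivable_cst.
exact: bmeas_derivableD.
Qed.

Hypothesis bD : bounded_set D.

Lemma bounded_coord : exists C, forall x, D x -> `|x.1| <= C /\ `|x.2| <= C.
Proof.
have [C [_ DC]] := bD; exists (C + 1) => x Dx.
have := DC (C + 1); rewrite ltrDl ltr01 => /(_ erefl x Dx).
by rewrite /= prod_normE ge_max => /andP[].
Qed.

(** Covers the two coordinate functions: their difference quotients are
    constant. *)
Lemma is_derive_linear_form (l : R * R -> R) (x v : R * R) :
  (forall h y, l (h *: v + y) = h * l v + l y) -> is_derive x v l (l v).
Proof.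
move=> lE.
have dl : h^-1 *: ((l \o shift x) (h *: v) - l x) @[h --> 0^'] --> l v.
  apply: cvg_near_cst; near=> h.
  by rewrite /= lE addrK scalerA mulVf ?scale1r//; near: h; exact: nbhs_dnbhs_neq.
apply: DeriveDef; last exact: cvg_lim dl.
by apply/cvg_ex; exists (l v).
Unshelve. all: by end_near. Qed.

Lemma bmeas_derivable_fst v : bmeas_derivable v fst.
Proof.
have [C DC] := bounded_coord; split.
  by split; [exact: measurable_fst|exists C => x /DC[]].
exists (cst v.1) => [|x]; [exact: bmeas_cst|exact: is_derive_linear_form].
Qed.

Lemma bmeas_derivable_snd v : bmeas_derivable v snd.
Proof.
have [C DC] := bounded_coord; split.
  by split; [exact: measurable_snd|exists C => x /DC[]].
exists (cst v.2) => [|x]; [exact: bmeas_cst|exact: is_derive_linear_form].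
Qed.

(** On the interior of each triangle the partial derivative is that of a
    polynomial.  These interiors are finitely many measurable sets, and nothing
    has to be known about their overlaps: where two of them meet, both
    polynomials give the derivative of [f]. *)
Lemma bmeas_partial Np (p : 'I_Np -> R * R) Th n b f :
  piecewise_poly p Th n f -> bmeas (partial p Th b f).
Proof.
move=> ppf.
have /choice[g gP] : forall K, exists g, K \in Th -> bmeas g /\
    forall x, (simplex p K)° x -> 'D_(unit_vec b) f x = g x.
  move=> K; have [KTh|] := boolP (K \in Th); last by exists f.
  have [c fE] := ppf K KTh.
  have [_ [g bg dg]] : bmeas_derivable (unit_vec b) (fun x =>
      \sum_(i < n.+1) \sum_(j < n.+1 | (i + j <= n)%N)
        c i j * x.1 ^+ i * x.2 ^+ j).
    apply: bmeas_derivable_sum => i _; apply: bmeas_derivable_sum => j _.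
    apply: bmeas_derivableM; first apply: bmeas_derivableM.
    - exact: bmeas_derivable_cst.
    - exact/bmeas_derivableX/bmeas_derivable_fst.
    - exact/bmeas_derivableX/bmeas_derivable_snd.
  exists g => _; split=> // x Kx; rewrite -(@derive_val _ _ _ _ _ _ _ (dg x)).
  by apply: near_eq_derive; apply: filterS Kx => y /fE.
set U := \bigcup_(K in [set K | K \in Th]) (simplex p K)°.
have mU : measurable (U : set (plane R)).
  by apply: open_measurable2; apply: bigcup_open => K _; exact: open_interior.
split.
  apply/(measurable_restrictT _ mU) => _ Y mY.
  suff -> : U `&` (fun x => 'D_(unit_vec b) f x) @^-1` Y =
      \bigcup_(K in [set K | K \in Th]) ((simplex p K)° `&` g K @^-1` Y).
    apply: fin_bigcup_measurable; first exact: finite_finset.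
    move=> K KTh; apply: measurableI.
      by apply: open_measurable2; exact: open_interior.
    by rewrite -[X in measurable X]setTI; apply: (gP K KTh).1.1.
  apply/seteqP; split => [x [[K KTh Kx] Yx]|x [K KTh [Kx Yx]]].
    by exists K => //; split=> //; rewrite /preimage/= -(gP K KTh).2.
  by split; [exists K|rewrite /preimage/= (gP K KTh).2].
have /choice[C CP] : forall K, exists C,
    K \in Th -> forall x, D x -> `|g K x| <= C.
  move=> K; have [KTh|] := boolP (K \in Th); last by exists 0.
  by have [[_ [C gC]] _] := gP K KTh; exists C.
(* A point may lie in any of the interiors: the sum dominates each bound. *)
exists (\sum_(K in Th) `|C K|) => x Dx; rewrite /partial patchE.
case: ifPn => [/set_mem[K KTh Kx]|_]; last by rewrite normr0 sumr_ge0.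
rewrite (gP K KTh).2// (le_trans (CP K KTh x Dx))// (bigD1 K)//=.
by rewrite (le_trans (ler_norm _))// lerDl sumr_ge0.
Qed.

End Plane.

(** * Essentially bounded weights and weighted integrals *)

Section EssBounded.
Context {R : realType}.
Variable D : set (R * R).

Definition ae_bounded (f : R * R -> R) C :=
  {ae leb2, forall x : plane R, D x -> `|f x| <= C}.

(** [L^oo(D)] stated through an explicit almost everywhere bound, a form that
    is stable under products, powers and the exponential by inspection. *)
Definition ess_bounded (f : R * R -> R) :=
  measurable_fun (D : set (plane R)) (f : plane R -> R) /\
  exists C, ae_bounded f C.

Lemma ess_bounded_cst a : ess_bounded (cst a).
Proof. by split; [exact: measurable_cst|exists `|a|; apply: aeW]. Qed.

Lemma ess_boundedD f g : ess_bounded f -> ess_bounded g -> ess_bounded (f \+ g).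
Proof.
move=> [mf [C fC]] [mg [C' gC]]; split; first exact: measurable_funD.
exists (C + C'); apply: filterS2 fC gC => x fx gx Dx.
by rewrite (le_trans (ler_normD _ _))// lerD ?fx ?gx.
Qed.

Lemma ess_boundedM f g : ess_bounded f -> ess_bounded g -> ess_bounded (f \* g).
Proof.
move=> [mf [C fC]] [mg [C' gC]]; split; first exact: measurable_funM.
exists (C * C'); apply: filterS2 fC gC => x fx gx Dx.
by rewrite normrM ler_pM ?fx ?gx.
Qed.

Lemma ess_boundedX f n : ess_bounded f -> ess_bounded (fun x => f x ^+ n).
Proof.
move=> bf; elim: n => [|n IH]; first exact: (ess_bounded_cst 1).
rewrite (_ : (fun x => _) = f \* (fun x => f x ^+ n)); first exact: ess_boundedM.
by apply/funext => x; rewrite /= exprS.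
Qed.

Lemma ess_bounded_sum I (r : seq I) (P : pred I) (f : I -> R * R -> R) :
  (forall i, P i -> ess_bounded (f i)) ->
  ess_bounded (fun x => \sum_(i <- r | P i) f i x).
Proof.
move=> bf; rewrite -fct_sumE; elim/big_ind: _ => //; first exact: ess_bounded_cst.
exact: ess_boundedD.
Qed.

Lemma ess_bounded_prod I (r : seq I) (P : pred I) (f : I -> R * R -> R) :
  (forall i, P i -> ess_bounded (f i)) ->
  ess_bounded (fun x => \prod_(i <- r | P i) f i x).
Proof.
move=> bf; rewrite -fct_prodE; elim/big_ind: _ => //; first exact: ess_bounded_cst.
exact: ess_boundedM.
Qed.

Lemma ess_bounded_expR f : ess_bounded f -> ess_bounded (fun x => expR (f x)).
Proof.
move=> [mf [C fC]]; split; first exact: measurableT_comp.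
exists (expR C); apply: filterS fC => x fx Dx.
by rewrite ger0_norm ?expR_ge0// ler_expR (le_trans (ler_norm _)) ?fx.
Qed.

Hypothesis oD : open D.

Let mD : measurable (D : set (plane R)). Proof. exact: open_measurable2. Qed.

(** The norm at exponent infinity is set to zero on a null space, where the
    claim holds vacuously; otherwise it is an essential supremum. *)
Lemma ae_le_norm_Linfty f : (norm_Linfty D f < +oo)%E ->
  ae_bounded f (fine (norm_Linfty D f)).
Proof.
rewrite /norm_Linfty unlock /=; case: ifPn => [_|].
  have := ess_sup_ge leb2 (abse \o (EFin \o f \_ D)).
  set e := ess_sup _ _ => fe; move: e fe => [e||]// fe _.
    apply: filterS fe => x /= fx Dx.
    by move: fx; rewrite patchE mem_set// lee_fin.
  by apply: filterS fe => x.
rewrite -leNgt => T0 _; exists setT; split => //.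
by apply/eqP; rewrite eq_le T0 measure_ge0.
Qed.

Lemma Linfty_ess_bounded f : Linfty D f -> ess_bounded f.
Proof.
move=> /andP[/=]; rewrite !inE => mf fin; split.
  by apply/(measurable_restrictT _ mD); exact: mf.
exists (fine (norm_Linfty D f)); exact: ae_le_norm_Linfty.
Qed.

Lemma ess_bounded_norm_lty f : ess_bounded f -> (norm_Linfty D f < +oo)%E.
Proof.
move=> [_ [C fC]]; rewrite /norm_Linfty unlock /=; case: ifPn => // _.
apply: (@le_lt_trans _ _ `|C|%:E); last exact: ltry.
apply/ess_supP; apply: filterS fC => x fx /=; rewrite lee_fin patchE.
case: ifPn => [/set_mem/fx|]; last by rewrite normr0.
by move=> /le_trans; apply; exact: ler_norm.
Qed.

Hypothesis bD : bounded_set D.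

Lemma leb2_bounded_lty : (leb2 (D : set (plane R)) < +oo)%E.
Proof.
have [C DC] := bounded_coord bD.
have mI : measurable (`[- C, C]%classic : set (measurableTypeR R)).
  exact: measurable_itv.
apply: (@le_lt_trans _ _ (leb2 (`[- C, C] `*` `[- C, C] : set (plane R)))).
  apply: le_measure; rewrite ?inE//; first exact: measurableX.
  by move=> x /DC[]; rewrite !ler_norml => x1 x2; split; rewrite /= in_itv.
have E := product_measure1E (@lebesgue_measure R) (@lebesgue_measure R) mI mI.
rewrite [X in (X < _)%E]E.
have IC : lebesgue_measure (`[- C, C]%classic : set (measurableTypeR R))
    \is a fin_num.
  by rewrite lebesgue_measure_itv/=; case: ifP.
by rewrite ltey_eq fin_numM.
Qed.

Lemma bmeas_integrable w : bmeas D w -> leb2.-integrable D (EFin \o w).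
Proof.
move=> [mw [C wC]]; apply: measurable_bounded_integrable => //.
- exact: leb2_bounded_lty.
- exact: measurable_funTS.
- exists C; split=> [|c Cc x /wC/le_trans]; first exact: num_real.
  by apply; exact: ltW.
Qed.

Section Weighted.
Variables (nu : R * R -> R) (C : R).
Hypotheses (mnu : measurable_fun (D : set (plane R)) (nu : plane R -> R)).
Hypothesis nuC : ae_bounded nu C.

(** A weight bounded only almost everywhere calls for the comparison of
    integrals of nonnegative functions, which tolerates null sets; the
    integrability of weighted functions follows. *)
Lemma ae_weighted_le w u : bmeas D w -> bmeas D u -> (forall x, `|w x| <= u x) ->
  (\int[leb2]_(x in D) `|(nu x * w x)%:E| <=
   \int[leb2]_(x in D) (`|C| * u x)%:E)%E.
Proof.
move=> [mw _] [mu _] wu.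
have u0 x : 0 <= u x by exact: le_trans (wu x).
apply: ae_ge0_le_integral => //.
- by do 2 apply: measurableT_comp => //; apply: measurable_funM => //;
    exact: measurable_funTS.
- by move=> x _; rewrite lee_fin mulr_ge0.
- by apply: measurableT_comp => //; apply: measurable_funM => //;
    exact: measurable_funTS.
apply: filterS nuC => x nux Dx; rewrite lee_fin normrM.
by apply: ler_pM => //; rewrite (le_trans (nux Dx))// ler_norm.
Qed.

Lemma weighted_integrable w : bmeas D w ->
  leb2.-integrable D (EFin \o (fun x => nu x * w x)).
Proof.
move=> bw; have [mw [c wc]] := bw.
have bn : bmeas D (fun x => `|w x|).
  by split; [exact: measurableT_comp|exists c => x /wc; rewrite normr_id].
apply/integrableP; split.
  by apply: measurableT_comp => //; apply: measurable_funM => //;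
    exact: measurable_funTS.
apply: le_lt_trans (ae_weighted_le bw bn _) _ => //.
have := bmeas_integrable (bmeasM (bmeas_cst D `|C|) bn) => /integrableP[_].
apply: le_lt_trans; apply: ge0_le_integral => //.
- apply: measurableT_comp => //; apply: measurable_funM => //.
  by apply: measurable_funTS; exact: bn.1.
- do 2 apply: measurableT_comp => //; apply: measurable_funM => //.
  by apply: measurable_funTS; exact: bn.1.
by move=> x _; rewrite lee_fin /= ler_norm.
Qed.

Lemma weighted_Rintegral_le w u : 0 <= C -> bmeas D w -> bmeas D u ->
  (forall x, `|w x| <= u x) ->
  \int[leb2]_(x in D) (nu x * w x) <= C * \int[leb2]_(x in D) u x.
Proof.
move=> C0 bw bu wu; have iu := bmeas_integrable bu.
rewrite -RintegralZl// (le_trans (ler_norm _))//.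
rewrite (le_trans (le_normr_Rintegral _ (weighted_integrable bw)))//.
have := ae_weighted_le bw bu wu; rewrite ger0_norm// => H.
apply: fine_le H.
- apply: integrable_fin_num => //; exact/integrable_norm/weighted_integrable.
- apply: integrable_fin_num => //.
  exact: (bmeas_integrable (bmeasM (bmeas_cst D C) bu)).
Qed.

Lemma weighted_Rintegral_sum I (r : seq I) (c : I -> R) (w : I -> R * R -> R) :
  (forall i, bmeas D (w i)) ->
  \sum_(i <- r) c i * \int[leb2]_(x in D) (nu x * w i x) =
  \int[leb2]_(x in D) (nu x * \sum_(i <- r) c i * w i x).
Proof.
move=> bw; elim: r => [|i r IH].
  by rewrite big_nil; under eq_Rintegral do rewrite big_nil mulr0;
     rewrite Rintegral_cst// mul0r.
rewrite big_cons IH -RintegralZl//; last exact: weighted_integrable.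
rewrite -RintegralD//; last 2 first.
- rewrite (_ : _ \o _ = EFin \o (fun x => nu x * (c i * w i x))).
    by apply: weighted_integrable; apply: bmeasM => //; exact: bmeas_cst.
  by apply/funext => x /=; rewrite mulrCA.
- apply: weighted_integrable; apply: bmeas_sum => j _.
  by apply: bmeasM => //; exact: bmeas_cst.
by apply: eq_Rintegral => x _; rewrite big_cons mulrDr mulrCA.
Qed.

End Weighted.
End EssBounded.

(** * Weighted stiffness matrices and the Schur complement *)

Section Stiffness.
Context {R : realType} {Np Nu : nat}.
Variables (D : set (R * R)) (oD : open D) (bD : bounded_set D).
Variables (p : 'I_Np -> R * R) (Th : {set {set 'I_Np}}).
Variable phi : 'I_Nu -> 'I_2 -> R * R -> R.
Hypothesis pw_phi : forall i a, exists n, piecewise_poly p Th n (phi i a).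

Let mD : measurable (D : set (plane R)). Proof. exact: open_measurable2. Qed.

(** The integrand of the unweighted stiffness matrix, kept as a matrix at each
    point so that tensor products can be formed before integration. *)
Definition gram x : 'M[R]_Nu := \matrix_(i, j) grad_dot p Th (phi i) (phi j) x.

Lemma bmeas_grad_dot i j : bmeas D (grad_dot p Th (phi i) (phi j)).
Proof.
apply: bmeas_sum => a _; apply: bmeas_sum => b _; apply: bmeasM.
  by have [n pn] := pw_phi i a; exact: (bmeas_partial bD b pn).
by have [n pn] := pw_phi j a; exact: (bmeas_partial bD b pn).
Qed.

Lemma bmeas_quad_gram m (G : 'M[R]_m) v :
  bmeas D (fun x => quad (G *t gram x) v).
Proof.
under eq_fun do rewrite quadE.
apply: bmeas_sum => i _; apply: bmeas_sum => j _.
apply: bmeasM; last exact: bmeas_cst.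
under eq_fun do rewrite !mxE.
by apply: bmeasM; [exact: bmeas_cst|exact: bmeas_grad_dot].
Qed.

(** The form of the tensor product is a finite linear combination of entries
    of the stiffness matrix, so it can be taken under the integral sign. *)
Lemma quad_stiffness m (G : 'M[R]_m) nu v : ess_bounded D nu ->
  quad (G *t stiffness_mx D p Th phi nu) v =
  \int[leb2]_(x in D) (nu x * quad (G *t gram x) v).
Proof.
move=> [mnu [C nuC]].
rewrite quadE pair_big /=.
pose c (q : 'I_(m * Nu) * 'I_(m * Nu)) :=
  G (mxtens_unindex q.1).1 (mxtens_unindex q.2).1 * (v q.1 0 * v q.2 0).
transitivity (\sum_q c q * \int[leb2]_(x in D)
    (nu x * gram x (mxtens_unindex q.1).2 (mxtens_unindex q.2).2)).
  apply: eq_bigr => q _; rewrite /c !mxE mulrAC; congr (_ * _).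
  by apply: eq_Rintegral => x _; rewrite mxE.
rewrite (weighted_Rintegral_sum oD bD mnu nuC); last first.
  by move=> q; under eq_fun do rewrite mxE; exact: bmeas_grad_dot.
apply: eq_Rintegral => x _; congr (_ * _).
by rewrite quadE pair_big; apply: eq_bigr => q _; rewrite /c !mxE mulrAC.
Qed.

Definition dphi (a b : 'I_2) x : 'cV[R]_Nu := \col_k partial p Th b (phi k a) x.

Lemma gramE x : gram x = \sum_a \sum_b dphi a b x *m (dphi a b x)^T.
Proof.
apply/matrixP => i j; rewrite mxE summxE; apply: eq_bigr => a _.
rewrite summxE; apply: eq_bigr => b _.
by rewrite mxE big_ord1 !mxE.
Qed.

(** Pointwise, the Gram matrix of the gradients is a sum of four rank one
    matrices, one for each component and direction. *)
Lemma quad_tens_gram m (G : 'M[R]_m) v x :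
  quad (G *t gram x) v = \sum_a \sum_b
    quad G (\col_i ((slice v i)^T *m dphi a b x) 0 0).
Proof.
rewrite gramE tensmx_sumr quad_sum; apply: eq_bigr => a _.
rewrite tensmx_sumr quad_sum; apply: eq_bigr => b _.
exact: quad_tens_rank1.
Qed.

(** Two-sided bounds on [G] pass to [G *t A_nu], since they can be used at
    each point of [D] before integrating. *)
Lemma quad_tens_stiffness_le m (G : 'M[R]_m) g nu C :
  measurable_fun (D : set (plane R)) (nu : plane R -> R) ->
  ae_bounded D nu C -> 0 <= C ->
  (forall w, `|quad G w| <= g * quad 1%:M w) ->
  forall v, quad (G *t stiffness_mx D p Th phi nu) v <=
    g * C * quad (1%:M *t stiffness_mx D p Th phi (fun=> 1)) v.
Proof.
move=> mnu nuC C0 Gg v.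
rewrite quad_stiffness; last by split=> //; exists C.
rewrite quad_stiffness; last exact: ess_bounded_cst.
have b1 := bmeas_quad_gram 1%:M v.
have le_gram x : `|quad (G *t gram x) v| <= g * quad (1%:M *t gram x) v.
  rewrite !quad_tens_gram (le_trans (ler_norm_sum _ _ _))// mulr_sumr.
  apply: ler_sum => a _; rewrite (le_trans (ler_norm_sum _ _ _))// mulr_sumr.
  by apply: ler_sum => b _.
have := weighted_Rintegral_le oD bD mnu nuC C0 (bmeas_quad_gram G v)
  (bmeasM (bmeas_cst D g) b1) le_gram.
move=> /le_trans; apply; rewrite [X in _ * X]RintegralZl//; last first.
  exact: bmeas_integrable.
by rewrite mulrA (mulrC C); under [X in _ <= _ * X]eq_Rintegral do rewrite mul1r.
Qed.

Lemma stiffness_mx_sym nu :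
  (stiffness_mx D p Th phi nu)^T = stiffness_mx D p Th phi nu.
Proof.
apply/matrixP => i j; rewrite !mxE; apply: eq_Rintegral => x _; congr (_ * _).
by apply: eq_bigr => a _; apply: eq_bigr => b _; rewrite mulrC.
Qed.

End Stiffness.

(** Only the products [sqrt lam_m mu_m] are known to be essentially bounded;
    the coefficient is a continuous function of [mu0] and of these products,
    because [lam_m mu_m^2] is the square of such a product. *)
Lemma ess_bounded_nu_coeff (R : realType) (D : set (R * R)) M sigma mu0 lam mu
    (a : {ffun 'I_M -> nat}) : open D ->
  (forall m, (0 < m)%N -> 0 <= lam m) -> Linfty D mu0 ->
  (forall m, (0 < m)%N -> Linfty D (fun x => Num.sqrt (lam m) * mu m x)) ->
  ess_bounded D (nu_coeff sigma mu0 lam mu a).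
Proof.
move=> oD lam0 bmu0 bmu.
pose s m x := Num.sqrt (lam m) * mu m x.
have bs (m : 'I_M) : ess_bounded D (s m.+1).
  by apply: Linfty_ess_bounded => //; exact: bmu.
rewrite (_ : nu_coeff _ _ _ _ _ = fun x =>
  expR (mu0 x + 2^-1 * sigma ^+ 2 * \sum_(m < M) s m.+1 x ^+ 2) *
  \prod_(m < M) ((sigma * s m.+1 x) ^+ a m * (Num.sqrt ((a m)`!)%:R)^-1)).
  apply: ess_boundedM.
    apply: ess_bounded_expR; apply: ess_boundedD; first exact: Linfty_ess_bounded.
    apply: ess_boundedM; first exact: ess_bounded_cst.
    by apply: ess_bounded_sum => m _; exact: ess_boundedX.
  apply: ess_bounded_prod => m _; apply: ess_boundedM; last exact: ess_bounded_cst.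
  by apply: ess_boundedX; apply: ess_boundedM => //; exact: ess_bounded_cst.
apply/funext => x; rewrite /nu_coeff /s; congr (expR (_ + _ * _) * _).
  by apply: eq_bigr => m _; rewrite exprMn sqr_sqrtr// lam0.
by apply: eq_bigr => m _; rewrite mulrA.
Qed.

Lemma nu_bar_ge0 (R : realType) M sigma (mu0 : R * R -> R) lam mu D
    (a : {ffun 'I_M -> nat}) : 0 <= nu_bar sigma mu0 lam mu D a.
Proof. by apply: fine_ge0; exact: Lnorm_ge0. Qed.

Theorem lemma3 (R : realType)
  (* domain *)
  (D : set (R * R)) (hD : bounded_domain D)
  (* random input *)
  (M k : nat) (sigma_mu : R) (hsigma : 0 < sigma_mu)
  (d : measure_display) (Omega : measurableType d) (P : probability Omega R)
  (z : R * R -> {RV P >-> R}) (c : R * R -> R * R -> R)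
  (mu0 : R * R -> R) (lam : nat -> R) (mu : nat -> R * R -> R)
  (hz : gaussian_field D z mu0 (fun x x' => sigma_mu ^+ 2 * c x x'))
  (hKL : KL_eigenpairs D c lam mu)
  (hmu0 : Linfty D mu0)
  (hmu : forall m, (0 < m)%N -> Linfty D (fun x => Num.sqrt (lam m) * mu m x))
  (hl1 : (\sum_(1 <= m <oo)
            norm_Linfty D (fun x => Num.sqrt (lam m) * mu m x)%R < +oo)%E)
  (* Hermite chaos *)
  (alpha : nat -> {ffun 'I_M -> nat}) (halpha : chaos_enum k alpha)
  (* Taylor-Hood finite elements *)
  (h : R) (Np : nat) (p : 'I_Np -> R * R) (Th : {set {set 'I_Np}})
  (hTh : regular_triangulation D p Th h)
  (Nu : nat) (phi : 'I_Nu -> 'I_2 -> R * R -> R)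
  (hphi : V0h_basis D p Th phi)
  (vphi : 'I_Np -> R * R -> R) (hvphi : P1_nodal_basis D p Th vphi) :
  let Q_z := chaos_dim (M := M) k in
  let Q_nu := chaos_dim (M := M) (2 * k) in
  let nu_ q := nu_coeff sigma_mu mu0 lam mu (alpha q) in
  let nubar q := nu_bar sigma_mu mu0 lam mu D (alpha q) in
  let nusigma := nu_sigma sigma_mu mu0 lam mu k D alpha in
  let I := 1%:M : 'M[R]_Q_z in
  let G q := galerkin_mx k alpha q : 'M[R]_Q_z in
  let A_ q := stiffness_mx D p Th phi (nu_ q) in
  let A := stiffness_mx D p Th phi (fun=> 1) in
  let B := divergence_mx D p Th phi vphi in
  let M_p := mass_mx D vphi in
  let D_p := diag_part M_p in
  let calA := I *t A_ 0%N + \sum_(1 <= q < Q_nu) G q *t A_ q in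
  let calB := I *t B in
  forall
  (* inclusion bound for the stochastic Galerkin matrices *)
  (hG : forall q, (1 <= q < Q_nu)%N -> forall a : 'cV[R]_Q_z, a != 0 ->
     - g_const k alpha q <= quad (G q) a / (a^T *m a) 0 0 <= g_const k alpha q)
  (* pressure mass matrix *)
  (theta Theta : R) (htheta : 0 < theta) (hTheta : 0 < Theta)
  (hMp : forall q : 'cV[R]_Np, q != 0 ->
     theta <= quad M_p q / quad D_p q <= Theta)
  (* multigrid V-cycle *)
  (Amg : 'M[R]_Nu) (hAmg : SPD Amg)
  (delta Delta : R) (hdelta : 0 < delta) (hDelta : 0 < Delta)
  (hmg : forall v : 'cV[R]_Nu, v != 0 ->
     delta <= quad A v / quad Amg v <= Delta)
  (udelta : R) (hudelta : 0 < udelta)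
  (hcalA_mg : forall v : 'cV[R]_(Q_z * Nu),
     udelta * quad (I *t Amg) v <= quad calA v)
  (* well-posedness and inf-sup condition *)
  (hcalA : SPD calA)
  (beta : R) (hbeta : 0 < beta)
  (hinfsup : forall q : 'cV[R]_(Q_z * Np), q != 0 ->
     coeff_of_Sk_W0h D p Th alpha vphi q ->
     beta ^+ 2 <= quad (I *t (B *m invmx A *m B^T)) q / quad (I *t M_p) q <= 1),
  let gamma := (nubar 0%N + nusigma)^-1 * theta * beta ^+ 2 in
  let Gamma := udelta^-1 * Delta * Theta in
  forall q : 'cV[R]_(Q_z * Np), q != 0 ->
    coeff_of_Sk_W0h D p Th alpha vphi q ->
    gamma <= quad (calB *m invmx calA *m calB^T) q / quad (I *t D_p) q <= Gamma.
Proof.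
move=> Q_z Q_nu nu_ nubar nusigma I G A_ A B M_p D_p calA calB hG.
move=> theta Theta htheta hTheta hMp Amg hAmg delta Delta hdelta hDelta hmg.
move=> udelta hudelta hcalA_mg hcalA beta hbeta hinfsup.
have [D0 oD cD bD] := hD; have [lam0 _ _ _] := hKL.
have pw_phi i a : exists n, piecewise_poly p Th n (phi i a).
  by exists 2%N; have [[]] := hphi.1 i a.
have bnu q : ess_bounded D (nu_ q) by exact: ess_bounded_nu_coeff.
have nuC q : ae_bounded D (nu_ q) (nubar q).
  by apply: ae_le_norm_Linfty; exact: ess_bounded_norm_lty.
have nubar0 q : 0 <= nubar q by exact: nu_bar_ge0.
set c0 := nubar 0%N + nusigma.
have c0_ge0 : 0 <= c0.
  apply: addr_ge0 => //; apply: sumr_ge0 => q _.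
  by apply: mulr_ge0; [exact: expR_ge0|exact: nu_bar_ge0].
have calA_le v : quad calA v <= c0 * quad (I *t A) v.
  rewrite quadD quad_sum mulrDl lerD//.
    (* The mean term: the identity satisfies the bound with constant 1. *)
    have := quad_tens_stiffness_le oD bD pw_phi (bnu 0%N).1 (nuC 0%N) (nubar0 0%N)
      (G := I) (g := 1).
    by rewrite mul1r; apply => w; rewrite mul1r ger0_norm// quad_id_ge0.
  rewrite /nusigma /nu_sigma mulr_suml; apply: ler_sum_nat => q Hq.
  apply: (quad_tens_stiffness_le oD bD pw_phi (bnu q).1 (nuC q) (nubar0 q)) => w.
  have [->|w0] := eqVneq w 0; first by rewrite !quad0r normr0 mulr0.
  have w1 := quad_id_gt0 w0.
  have := hG q Hq w w0; rewrite -quad_id ler_pdivlMr// ler_pdivrMr//.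
  by rewrite mulNr -ler_norml.
have Amg_gt0 := hAmg.2.
have sA : SPD A.
  split; first exact: stiffness_mx_sym.
  move=> v v0; have /andP[+ _] := hmg v v0.
  rewrite ler_pdivlMr ?Amg_gt0//; apply: lt_le_trans.
  by rewrite mulr_gt0 ?Amg_gt0.
have sL : SPD (I *t A) by exact: SPD_tens1.
have A_le v : quad A v <= Delta * quad Amg v.
  have [->|v0] := eqVneq v 0; first by rewrite !quad0r mulr0.
  by have /andP[_] := hmg v v0; rewrite ler_pdivrMr// Amg_gt0.
have L_le v : quad (I *t A) v <= Delta / udelta * quad calA v.
  rewrite mulrAC -mulrA -ler_pdivrMl//.
  apply: (@le_trans _ _ (quad (I *t Amg) v)).
    rewrite ler_pdivrMl// -quadZ -tensmxZr; apply: quad_tens1_le => w.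
    by rewrite quadZ.
  by rewrite ler_pdivlMr// mulrC.
move=> gamma Gamma q q0 qW.
set S := quad (calB *m _ *m _) q; set Y := quad (I *t D_p) q.
have /andP[] := hinfsup q q0 qW.
set T := quad _ q; set X := quad _ q.
(* Both Schur complements are forms of inverses at the same vector. *)
have TE : T = quad (invmx (I *t A)) (calB^T *m q).
  rewrite -quad_congr invmx_tens1 ?SPD_unitmx// /calB trmx_tens trmx1.
  by rewrite !tensmx_mul !mulmx1.
have SE : S = quad (invmx calA) (calB^T *m q) by rewrite -quad_congr.
have ST : S <= Delta / udelta * T.
  by rewrite SE TE; apply: SPD_inv_le => //; rewrite divr_gt0.
(* Testing the dual inequality with the zero vector. *)
have S0 : 0 <= S.
  have := SPD_dual_le hcalA (calB^T *m q) 0.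
  by rewrite -SE quad0r mulmx0 mxE mulr0 subr0.
(* The diagonal entries of the mass matrix are integrals of squares; a zero
   denominator would make the quotient zero, against the bound theta > 0. *)
have Dp_gt0 v : v != 0 -> 0 < quad D_p v.
  move=> v0; rewrite lt_def; apply/andP; split.
    have /andP[+ _] := hMp v v0; apply: contraTneq => ->.
    by rewrite invr0 mulr0 -ltNge.
  rewrite quad_diag_part; apply: sumr_ge0 => i _; apply: mulr_ge0 (sqr_ge0 _).
  by rewrite mxE; apply: Rintegral_ge0 => x _; rewrite -expr2 sqr_ge0.
have XY : theta * Y <= X <= Theta * Y.
  rewrite /X /Y -!quadZ -!tensmxZr; apply/andP; split; apply: quad_tens1_le => v;
    rewrite quadZ; have [->|v0] := eqVneq v 0; rewrite ?quad0r ?mulr0//;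
    have := hMp v v0; rewrite ler_pdivlMr ?Dp_gt0// ler_pdivrMr ?Dp_gt0//.
    by case/andP.
  by case/andP.
have Y0 : 0 < Y.
  have [i qi] := slice_neq0 q0; rewrite /Y quad_tens1 (bigD1 i)//=.
  rewrite ltr_pwDl ?Dp_gt0// sumr_ge0// => j _.
  by have [->|/Dp_gt0/ltW//] := eqVneq (slice q j) 0; rewrite quad0r.
have /andP[thY XT] := XY.
have X0 : 0 < X by rewrite (lt_le_trans _ thY)// mulr_gt0.
rewrite ler_pdivlMr// ler_pdivrMr// mul1r => bX TX.
rewrite ler_pdivlMr// ler_pdivrMr//; apply/andP; split; last first.
  rewrite (le_trans ST)// (_ : Gamma * Y = Delta / udelta * (Theta * Y)).
    by apply: ler_wpM2l; [rewrite divr_ge0 ?ltW|exact: le_trans XT].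
  by rewrite /Gamma; ring.
rewrite /gamma -/c0.
(* If [c0] is zero then so is the lower bound, and [S] is nonnegative. *)
have [c00|c0n] := eqVneq c0 0; first by rewrite c00 invr0 !mul0r.
have c0_gt0 : 0 < c0 by rewrite lt_def c0n.
have TS : T <= c0 * S by rewrite SE TE; exact: SPD_inv_le.
rewrite (_ : _ * Y = c0^-1 * (beta ^+ 2 * (theta * Y))); last by ring.
rewrite ler_pdivrMl//; apply: le_trans TS; apply: le_trans bX.
by rewrite ler_wpM2l ?sqr_ge0.
Qed.
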